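(* Let $g\ge3$, $2\le k<g$ and $m\ge2$ be integers. Suppose that there are exactly $m-1$ distinct integers $r$ such that $$a=r\,\frac{kg-1}{k^2-1}<g\quad\text{and}\quad b=r\,\frac{g-k}{k^2-1}$$ are positive integers, and suppose that the $(g,k)$ Young graph is the complete graph $K_m$. Let $r_0$ be the smallest of these $m-1$ values of $r$. Then: (i) The non-starting nodes of the Young graph are $[ir_0,ir_0]$, $0\le i\le m-1$, and the edge from the starting node (for $1\le i\le m-1$), and from the node $[0,0]$, to $[ir_0,ir_0]$ has label $\bigl(ir_0(g-k)/(k^2-1),\ ir_0(kg-1)/(k^2-1)\bigr)$. (ii) The generating function of the $(g,k)$-reverse multiples is $$\mathcal C(x)=\frac{(m-1)x^2(1+x)}{1-mx^2}=(m-1)\bigl(x^2+x^3+mx^4+mx^5+m^2x^6+m^2x^7+\cdots\bigr).$$ (iii) The $(g,k)$-reverse multiples are exactly the numbers $\gamma\beta$, where $\gamma=\bigl(r_0(g-k)/(k^2-1),\ r_0(kg-1)/(k^2-1)\bigr)_g$ (a two-digit base-$g$ number) and $\beta$ ranges over all positive integers whose base-$g$ expansion is palindromic and uses only the digits $0,1,\dots,m-1$.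
   Context: Notation: $(a_{n-1},\dots,a_1,a_0)_g$ denotes $\sum_{i=0}^{n-1}a_ig^i$ with digits $0\le a_i<g$; if $a_{n-1}\ne0$ it has length $n$. A positive integer $N=(a_{n-1},\dots,a_0)_g$ with $a_{n-1}\neq 0$ is a $(g,k)$-reverse multiple if $kN=(a_0,a_1,\dots,a_{n-1})_g$. Let $c_t$ be the number of $(g,k)$-reverse multiples of length $t$ and $\mathcal C(x)=\sum_{t\ge0}c_tx^t$. Young graph. The directed edge-labelled graph $H(g,k)$ is defined as follows. Its possible nodes are a distinguished starting node, written $[[0,0]]$, and ordered pairs $[s,r]$ of integers with $0\le s,r\le k-1$ (the pair $[0,0]$ is a node distinct from the starting node). For a node $[s,r]$ (the starting node being treated as $s=r=0$) and each pair of digits $(c,a)$, $0\le a,c\le g-1$, with $ka+r\equiv c \pmod g$ and $0\le a+sg-kc\le k-1$, there is a directed edge labelled $(c,a)$ from $[s,r]$ to the node $[\,a+sg-kc,\ (ka+r-c)/g\,]$; for edges leaving the starting node one additionally requires $a\ne0$ and $c\ne0$. $H(g,k)$ consists of the starting node, the nodes reachable from it by directed paths, and all edges leaving these nodes. A non-starting node of the form $[r,r]$ ($r\ge0$, including $[0,0]$) is an even pivot node; a non-starting node is an odd pivot node if it is of the form $[r,r]$ and carries a loop, or is of the form $[r',r]$ with $r'\ne r$ and has an edge to $[r,r']$. The $(g,k)$ Young graph exists if $H(g,k)$ contains a node $[r,r]$ with $r\ne0$ or an edge $[r',r]\to[r,r']$ with $r'\ne r$; it is then obtained from $H(g,k)$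 by deleting every node from which no pivot node can be reached by a directed path, together with all edges incident to such nodes. Complete graph $K_m$: a Young graph is the complete graph $K_m$ if it has exactly $m$ non-starting nodes, there is a directed edge from every non-starting node to every non-starting node (including a loop at each non-starting node), and the starting node has an edge to every non-starting node except $[0,0]$. *)

(* Defs.v *)
From mathcomp Require Import all_boot all_order all_algebra.
From Stdlib Require Import Relation_Operators.

Set Implicit Arguments.
Unset Strict Implicit.
Unset Printing Implicit Defensive.

Import Order.TTheory GRing.Theory Num.Theory.
Local Open Scope ring_scope.

Definition exactly (T : eqType) (n : nat) (P : T -> Prop) : Prop :=
  exists s : seq T, [/\ uniq s, size s = n & forall x, x \in s <-> P x].

(* Digit lists are written most significant digit first, so that
   [:: a_(n-1); ...; a_0] has value (a_(n-1), ..., a_0)_g. *)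
Definition numeral (g : nat) (ds : seq nat) : nat :=
  (\sum_(i < size ds) nth 0 (rev ds) i * g ^ i)%N.

(* The condition on the head also rejects the empty list. *)
Definition is_expansion (g : nat) (ds : seq nat) (N : nat) : bool :=
  [&& all (fun d => d < g)%N ds, head 0%N ds != 0%N & N == numeral g ds].

Definition revmul_len (g k t N : nat) : bool :=
  (0 < N)%N &&
  [exists a : t.-tuple 'I_g, let ds := [seq val d | d <- a] in
     is_expansion g ds N && (k * N == numeral g (rev ds))%N].

Definition revmul (g k N : nat) : Prop := exists t, revmul_len g k t N.

(* A number of length t is smaller than g ^ t. *)
Definition count_revmul (g k t : nat) : nat :=
  #|[set N : 'I_(g ^ t) | revmul_len g k t N]|.

Definition palindrome_below (g m N : nat) : Prop :=
  exists ds : seq nat,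
    [/\ is_expansion g ds N, rev ds = ds & all (fun d => d < m)%N ds].

(* Formal power series over the integers are coefficient sequences. *)
Definition series := nat -> int.

Definition poly_series (p : {poly int}) : series := fun n => p`_n.

Definition mul_series (f h : series) : series :=
  fun n => \sum_(i < n.+1) f i * h (n - i)%N.

(* f = p / q in Z[[x]]: q is invertible there iff q`_0 is a unit. *)
Definition series_is_frac (f : series) (p q : {poly int}) : Prop :=
  q`_0 \is a GRing.unit /\ mul_series (poly_series q) f =1 poly_series p.

Definition revmul_gf (g k : nat) : series := fun t => (count_revmul g k t)%:Z.

Definition digit_a (g k : nat) (r : int) : rat :=
  r%:~R * ((k%:R * g%:R - 1) / (k%:R ^+ 2 - 1)).

Definition digit_b (g k : nat) (r : int) : rat :=
  r%:~R * ((g%:R - k%:R) / (k%:R ^+ 2 - 1)).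

Definition admissible (g k : nat) (r : int) : Prop :=
  [/\ digit_a g k r \is a Num.int, 0 < digit_a g k r, digit_a g k r < g%:R,
      digit_b g k r \is a Num.int & 0 < digit_b g k r].

Inductive node := Start | Pair of int & int.

Definition possible (k : nat) (u : node) : bool :=
  if u is Pair s r then (0 <= s <= k%:Z - 1) && (0 <= r <= k%:Z - 1) else true.

Definition coords (u : node) : int * int :=
  if u is Pair s r then (s, r) else (0, 0).

Definition edge (g k : nat) (u : node) (c a : int) (v : node) : Prop :=
  let: (s, r) := coords u in
  let s' := a + s * g%:Z - k%:Z * c in
  let r' := ((k%:Z * a + r - c) %/ g%:Z)%Z in
  [/\ possible k u,
      (0 <= a <= g%:Z - 1) && (0 <= c <= g%:Z - 1),
      (k%:Z * a + r = c %[mod g%:Z])%Z /\ 0 <= s' <= k%:Z - 1,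
      u = Start -> a <> 0 /\ c <> 0
    & v = Pair s' r'].

Definition arrow (g k : nat) (u v : node) : Prop :=
  exists c a, edge g k u c a v.

Definition reach (g k : nat) : node -> node -> Prop :=
  clos_refl_trans node (arrow g k).

Definition H_node (g k : nat) (u : node) : Prop := reach g k Start u.

Definition H_arrow (g k : nat) (u v : node) : Prop :=
  H_node g k u /\ arrow g k u v.

Definition even_pivot (g k : nat) (u : node) : Prop :=
  H_node g k u /\ exists r, u = Pair r r.

Definition odd_pivot (g k : nat) (u : node) : Prop :=
  (exists r, u = Pair r r /\ H_arrow g k u u) \/
  (exists r' r, [/\ r' <> r, u = Pair r' r & H_arrow g k u (Pair r r')]).

Definition pivot (g k : nat) (u : node) : Prop :=
  even_pivot g k u \/ odd_pivot g k u.

Definition young_exists (g k : nat) : Prop :=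
  (exists r, r <> 0 /\ H_node g k (Pair r r)) \/
  (exists r' r, r' <> r /\ H_arrow g k (Pair r' r) (Pair r r')).

(* A path from a node of H stays in H, and pivots reach themselves by the
   empty path. *)
Definition young_node (g k : nat) (u : node) : Prop :=
  H_node g k u /\ exists p, pivot g k p /\ reach g k u p.

Definition young_edge (g k : nat) (u : node) (c a : int) (v : node) : Prop :=
  [/\ young_node g k u, young_node g k v & edge g k u c a v].

Definition young_arrow (g k : nat) (u v : node) : Prop :=
  exists c a, young_edge g k u c a v.

Definition young_is_complete (g k m : nat) : Prop :=
  [/\ young_exists g k,
      exactly m (fun p : int * int => young_node g k (Pair p.1 p.2)),
      forall s r s' r', young_node g k (Pair s r) ->
        young_node g k (Pair s' r') -> young_arrow g k (Pair s r) (Pair s' r')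
    & forall s r, young_node g k (Pair s r) -> (s, r) <> (0, 0) ->
        young_arrow g k Start (Pair s r)].

(* The Young graph has exactly one edge from u to v, and its label is (x, y). *)
Definition the_edge_label (g k : nat) (u v : node) (x y : rat) : Prop :=
  exists c a : int, [/\ c%:~R = x, a%:~R = y
    & forall c' a', young_edge g k u c' a' v <-> c' = c /\ a' = a].

(* Main.v *)
Require Import Defs.
From HB Require Import structures.
From mathcomp Require Import all_boot all_order all_algebra zify ring.
From Stdlib Require Import Relation_Operators.
Import Order.TTheory GRing.Theory Num.Theory.
Local Open Scope ring_scope.

(** In the coordinates [s, r], an edge [s, r] -> [s', r'] labelled (c, a) is a
    solution of the linear system a + s g = k c + s', k a + r = c + g r'.  Hence
    the nodes [r, r] joined to Start are those with r admissible.  The r at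
    which both label formulas are integral form a subgroup of Z, so the m - 1
    admissible ones are the first positive multiples of r0.  Reversing all edges
    while swapping coordinates preserves the graph, so the one remaining node of
    K_m is its own swap, which leaves only [0, 0].

    The carries e_i r0 of the multiplication of a reverse multiple N by k trace
    a path from Start to [0, 0] in the Young graph, hence are palindromic, and
    the i-th digit of N is e_(i+1) a + e_i b.  This says that
    N = (b g + a) * (e_(n-1), ..., e_1)_g.  Conversely, the loop at
    [(m-1) r0, (m-1) r0] gives (m - 1) (a + b) < g, so multiplying a palindrome
    with digits below m by b g + a involves no carry. *)

Set Implicit Arguments.
Unset Strict Implicit.
Unset Printing Implicit Defensive.

Local Notation digits_below n := (all (fun d => d < n)%N).

Lemma head_rev (T : Type) (x : T) s : head x (rev s) = last x s.
Proof. by case: (lastP s) => // s' y; rewrite rev_rcons last_rcons. Qed.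

Lemma rev_pairmap (S T : Type) (f f' : S -> S -> T) x y s :
    (forall u v, f u v = f' v u) ->
  rev (pairmap f x (rcons s y)) = pairmap f' y (rcons (rev s) x).
Proof.
move=> ff'; elim: s x => [|z s IHs] x /=; first by rewrite ff'.
by rewrite !rev_cons IHs -[in RHS]cats1 pairmap_cat last_rcons /= -ff' cats1.
Qed.

Lemma rev_mkseq_sym (T : Type) (f : nat -> T) n :
  (forall i, (i < n)%N -> f (n - i.+1)%N = f i) -> rev (mkseq f n) = mkseq f n.
Proof.
move=> f_sym; case: n f_sym => // n f_sym; apply: (@eq_from_nth _ (f 0%N)).
  by rewrite size_rev.
move=> i; rewrite size_rev size_mkseq => i_lt.
by rewrite nth_rev size_mkseq // !nth_mkseq ?f_sym // subSS ltnS leq_subr.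
Qed.

Lemma uniq_eq_cons (T : eqType) (s1 s2 : seq T) :
    uniq s1 -> uniq s2 -> {subset s1 <= s2} -> size s2 = (size s1).+1 ->
  exists2 x, x \notin s1 & s2 =i x :: s1.
Proof.
move=> uniq_s1 uniq_s2 s12 size_s2.
have /hasP[x s2x s1x] : has (predC (mem s1)) s2.
  rewrite has_predC; apply/allP => s21.
  by have := uniq_leq_size uniq_s2 s21; rewrite size_s2 ltnn.
have xs12 : {subset x :: s1 <= s2} by move=> y /predU1P[->|/s12].
have uniq_xs1 : uniq (x :: s1) by rewrite /= uniq_s1 andbT.
have [|_ eq_s] := uniq_min_size uniq_xs1 xs12; first by rewrite size_s2.
by exists x => // y; rewrite eq_s.
Qed.

Lemma eq_exactly (T : eqType) n n' (P P' : T -> Prop) :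
  (forall x, P x <-> P' x) -> exactly n P -> exactly n' P' -> n = n'.
Proof.
move=> PP' [s [uniq_s <- sP]] [s' [uniq_s' <- s'P]].
apply/perm_size/uniq_perm => // x.
by apply/idP/idP => [/sP/PP'/s'P|/s'P/PP'/sP].
Qed.

Lemma exactly_multiples (d : int) n : d != 0 ->
  exactly n (fun r => exists i : nat, (0 < i <= n)%N /\ r = i%:Z * d).
Proof.
move=> d_neq0; exists [seq i%:Z * d | i <- iota 1 n]; split=> [||r].
- by rewrite map_inj_uniq ?iota_uniq // => i j /(mulIf d_neq0)[].
- by rewrite size_map size_iota.
split=> [/mapP[i]|[i [i_le ->]]]; first by rewrite mem_iota => ? ->; exists i.
by apply: map_f; rewrite mem_iota.
Qed.

Section Numerals.
Local Open Scope nat_scope.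
Variable g : nat.

Definition lsd_value (l : seq nat) : nat := foldr (fun d n => d + g * n) 0 l.

Definition digit (N i : nat) : nat := N %/ g ^ i %% g.

Lemma numeralE ds : numeral g ds = lsd_value (rev ds).
Proof.
rewrite /numeral -size_rev; elim: (rev ds) => [|d l IHl].
  by rewrite big_ord0.
rewrite big_ord_recl muln1 /= -IHl big_distrr; congr (_ + _).
by apply: eq_bigr => i _; rewrite /bump add1n expnS mulnCA.
Qed.

Lemma numeral_rev l : numeral g (rev l) = lsd_value l.
Proof. by rewrite numeralE revK. Qed.

Lemma lsd_value_lt l : digits_below g l -> lsd_value l < g ^ size l.
Proof. by elim: l => //= d l IHl /andP[d_lt /IHl]; rewrite expnS; nia. Qed.

Lemma lsd_value_gt0 l : 0 < g -> last 0 l != 0 -> 0 < lsd_value l.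
Proof.
move=> g_gt0; elim: l => //= d [_ /=|e l /[apply] V_gt0].
  by rewrite muln0 addn0 lt0n.
by rewrite addn_gt0 muln_gt0 g_gt0 V_gt0 orbT.
Qed.

Lemma nth_digit l i : digits_below g l -> nth 0 l i = digit (lsd_value l) i.
Proof.
elim: l i => [|d l IHl] [|i] /=; rewrite /digit ?div0n ?mod0n //.
  by case/andP=> d_lt _; rewrite divn1 addnC mulnC modnMDl modn_small.
case/andP=> d_lt /IHl->; rewrite expnS divnMA addnC mulnC divnMDl; last by lia.
by rewrite (divn_small d_lt) addn0.
Qed.

Lemma lsd_value_inj l l' : size l = size l' ->
  digits_below g l -> digits_below g l' -> lsd_value l = lsd_value l' -> l = l'.
Proof.
move=> size_l l_lt l'_lt eqV.
by apply: (@eq_from_nth _ 0) => // i _; rewrite !nth_digit // eqV.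
Qed.

Lemma is_expansionE ds N :
  is_expansion g ds N = [&& digits_below g (rev ds), last 0 (rev ds) != 0
                          & N == lsd_value (rev ds)].
Proof. by rewrite /is_expansion numeralE all_rev -head_rev revK. Qed.

Lemma expansion_gt0 ds N : 0 < g -> is_expansion g ds N -> 0 < N.
Proof.
by rewrite is_expansionE => g_gt0 /and3P[_ ? /eqP->]; apply: lsd_value_gt0.
Qed.

(* When no sum reaches g, these are the digits of (b, a)_g times the number with
   digits l; all lists have the least significant digit first. *)
Definition scaled_digits (a b : nat) (l : seq nat) : seq nat :=
  pairmap (fun y x => x * a + y * b) 0 (rcons l 0).

Lemma size_scaled_digits a b l : size (scaled_digits a b l) = (size l).+1.
Proof. by rewrite size_pairmap size_rcons. Qed.

Lemma lsd_value_scaled a b l :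
  lsd_value (scaled_digits a b l) = (b * g + a) * lsd_value l.
Proof.
rewrite -[RHS]add0n -[X in X + _](mul0n b) /scaled_digits.
by elim: l {1 3}0 => [|x l IHl] y /=; rewrite ?IHl; ring.
Qed.

Lemma rev_scaled_digits a b l :
  rev (scaled_digits a b l) = scaled_digits b a (rev l).
Proof. by apply: rev_pairmap => x y; rewrite addnC. Qed.

Lemma last_scaled_digits a b l : last 0 (scaled_digits a b l) = last 0 l * b.
Proof. by rewrite /scaled_digits -cats1 pairmap_cat last_cat. Qed.

Lemma scaled_digits_below a b m l : digits_below m l -> (m - 1) * (a + b) < g ->
  digits_below g (scaled_digits a b l).
Proof.
move=> l_lt digit_bound.
have nth_le j : nth 0 l j <= m - 1.
  have [jl|jl] := ltnP j (size l); last by rewrite nth_default.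
  by move/all_nthP: l_lt => /(_ 0 j jl); lia.
apply/(all_nthP 0) => i; rewrite size_pairmap => i_lt.
rewrite (nth_pairmap 0) // nth_rcons_default.
have : nth 0 (0 :: rcons l 0) i <= m - 1.
  by case: i i_lt => //= i _; rewrite nth_rcons_default.
by have := nth_le i; nia.
Qed.

Variable k : nat.

Definition carry (N i : nat) : nat := k * (N %% g ^ i) %/ g ^ i.

Lemma carry0 N : carry N 0 = 0.
Proof. by rewrite /carry modn1 muln0. Qed.

Lemma carry_lt N i : 0 < g -> 0 < k -> carry N i < k.
Proof.
move=> g_gt0 k_gt0; have gi_gt0 : 0 < g ^ i by rewrite expn_gt0 g_gt0.
by rewrite ltn_divLR // ltn_pmul2l // ltn_mod.
Qed.

Lemma carry_eq0 N t : 0 < k -> k * N < g ^ t -> carry N t = 0.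
Proof.
move=> k_gt0 kN_lt; have N_lt : N < g ^ t by nia.
by rewrite /carry modn_small // divn_small.
Qed.

Lemma carryS N i : 0 < g ->
  k * digit N i + carry N i = digit (k * N) i + g * carry N i.+1.
Proof.
move=> g_gt0; have gi_gt0 : 0 < g ^ i by rewrite expn_gt0 g_gt0.
rewrite /digit /carry; set q := g ^ i in gi_gt0 *.
pose u := N %/ q; pose c := k * (N %% q) %/ q.
have modS : N %% g ^ i.+1 = u %% g * q + N %% q.
  rewrite {1}(divn_eq N q) -/u {1}(divn_eq u g) mulnDl -mulnA -expnS -addnA.
  rewrite modnMDl modn_small // expnS -/q.
  by have := ltn_pmod u g_gt0; have := ltn_pmod N gi_gt0; nia.
have carry_rec : k * (N %% g ^ i.+1) %/ g ^ i.+1 = (k * (u %% g) + c) %/ g.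
  by rewrite modS expnSr divnMA mulnDr mulnA divnMDl.
have digit_kN : k * N %/ q %% g = (k * (u %% g) + c) %% g.
  rewrite {1}(divn_eq N q) -/u mulnDr mulnA divnMDl //.
  by rewrite -[LHS]modnDml -modnMmr modnDml.
by rewrite carry_rec digit_kN [g * _]mulnC [RHS]addnC -divn_eq.
Qed.

End Numerals.

Section Palindromes.
Local Open Scope nat_scope.

Fixpoint palindromes (d m n : nat) : seq (seq nat) :=
  match n with
  | 0 => nseq (d == 0) [::]
  | 1 => [seq [:: x] | x <- iota d (m - d)]
  | n'.+2 => [seq x :: rcons l x | x <- iota d (m - d), l <- palindromes 0 m n']
  end.

Lemma mem_palindromes d m n l :
  (l \in palindromes d m n) =
  [&& size l == n, rev l == l, digits_below m l & d <= head 0 l].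
Proof.
elim/ltn_ind: n d l => -[|[|n]] IHn d l /=.
- by case: l => [|x l]; rewrite mem_nseq ?andbF //; case: d.
- case: l => [|x [|y l]]; rewrite ?andbF //=; first by apply/mapP => -[].
    rewrite mem_map ?mem_iota; first by rewrite /= eqxx andbT; lia.
    by move=> ? ? [].
  by apply/mapP => -[].
case: l => [|x l]; first by apply/allpairsP=> -[? []].
case/lastP: l => [|l y]; first by apply/allpairsP=> -[[z w] [_ _ /=]]; case: w.
rewrite rev_cons rev_rcons /= size_rcons all_rcons !eqSS eqseq_cons eqseq_rcons.
apply/allpairsP/idP => [[[z l'] /= [+ + [-> /rcons_inj[-> ->]]]]|].
  rewrite IHn // mem_iota => ? /and4P[-> -> -> _]; rewrite eqxx !andbT /=.
  by lia.
case/and4P=> size_l /and3P[/eqP-> pal_l _] /and3P[x_lt _ l_lt] d_le.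
exists (x, l); rewrite IHn // size_l pal_l l_lt mem_iota; split=> //=.
by move: x_lt d_le; lia.
Qed.

Lemma uniq_palindromes d m n : uniq (palindromes d m n).
Proof.
elim/ltn_ind: n d => -[|[|n]] IHn d /=; first by case: eqP.
  by rewrite map_inj_uniq ?iota_uniq // => x y [].
apply: allpairs_uniq; rewrite ?iota_uniq ?IHn // => -[x l] [y l'] _ _ /=.
by case=> -> /rcons_inj[->].
Qed.

Lemma size_palindromes d m n :
  size (palindromes d m n.+1) = (m - d) * m ^ n./2.
Proof.
elim/ltn_ind: n d => -[|[|n]] IHn d.
- by rewrite size_map size_iota muln1.
- by rewrite [LHS]size_allpairs size_iota.
by rewrite [LHS]size_allpairs size_iota IHn // subn0 -expnS.
Qed.

Lemma palindrome_digits_below g m n l : m <= g ->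
  l \in palindromes 1 m n -> digits_below g l.
Proof.
rewrite mem_palindromes => m_le /and4P[_ _ + _]; apply: sub_all => d d_lt.
exact: leq_trans d_lt m_le.
Qed.

Lemma palindrome_belowP g m N : m <= g ->
  palindrome_below g m N <->
  exists n l, l \in palindromes 1 m n /\ N = lsd_value g l.
Proof.
move=> m_le; split=> [[ds []]|[n [l [pal_l ->]]]].
  rewrite is_expansionE => /and3P[ds_lt ds_last /eqP->] pal_ds ds_m.
  exists (size ds), (rev ds); split=> //.
  rewrite mem_palindromes size_rev revK pal_ds !eqxx ds_m lt0n /=.
  by rewrite -pal_ds head_rev -pal_ds.
have l_lt := palindrome_digits_below m_le pal_l.
move: pal_l; rewrite mem_palindromes => /and4P[_ /eqP rev_l l_m l_head].
exists l; split=> //; rewrite is_expansionE rev_l l_lt eqxx andbT.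
by rewrite -head_rev rev_l -lt0n.
Qed.

End Palindromes.

Lemma two_step_recurrence_is_frac (f : series) (p : {poly int}) (m : int) :
    f 0%N = p`_0 -> f 1%N = p`_1 -> (forall n, f n.+2 = m * f n + p`_n.+2) ->
  series_is_frac f p (1 - m%:P * 'X^2).
Proof.
move=> f0 f1 f_rec.
have coef_den n : (1 - m%:P * 'X^2)`_n = (n == 0%N)%:R - m *+ (n == 2)%N.
  by rewrite coefB coef1 coefCM coefXn mulr_natr.
split; first by rewrite coef_den subr0 unitr1.
rewrite /mul_series /poly_series => -[|[|n]]; rewrite !big_ord_recl.
- by rewrite big_ord0 coef_den /= f0; ring.
- by rewrite big_ord0 !coef_den /= f1; ring.
rewrite big1 => [|i _]; last first.
  by rewrite coef_den /bump /= subrr mul0r.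
by rewrite !coef_den /bump /= !subSS !subn0 f_rec; ring.
Qed.

Lemma half_geometric_is_frac (f : series) (q m : int) :
    f 0%N = 0 -> f 1%N = 0 -> (forall n, f n.+2 = q * m ^+ n./2) ->
  series_is_frac f (q%:P * 'X^2 * (1 + 'X)) (1 - m%:P * 'X^2).
Proof.
move=> f0 f1 f_geo; set p := q%:P * _ * _.
have coef_p n : p`_n = q *+ (n == 2)%N + q *+ (n == 3)%N.
  by rewrite /p mulrDr mulr1 -mulrA -exprSr coefD !coefCM !coefXn !mulr_natr.
apply: two_step_recurrence_is_frac => [||[|[|n]]];
  rewrite coef_p ?f0 ?f1 ?f_geo ?exprS /=; ring.
Qed.

Lemma min_pos_dvdz (S : {pred int}) (d : int) :
    zmod_closed S -> d \in S -> 0 < d ->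
    (forall r, r \in S -> 0 < r -> d <= r) ->
  {in S, forall r, (d %| r)%Z}.
Proof.
move=> zmodS Sd d_gt0 d_min r Sr.
pose S' : zmodClosed int := HB.pack S (GRing.isZmodClosed.Build int S zmodS).
have Smod : (r %% d)%Z \in S.
  by rewrite /modz [_ * d]mulrC -mulrzz (@rpredB _ S') ?(@rpredMz _ S').
apply/dvdz_mod0P/eqP; rewrite eq_le modz_ge0 ?gt_eqF // andbT leNgt.
by apply/negP => /(d_min _ Smod); rewrite leNgt ltz_pmod.
Qed.

Section Edges.
Variables g k : nat.

Lemma edgeP s r c a s' r' : (0 < g)%N ->
  edge g k (Pair s r) c a (Pair s' r') <->
  [/\ possible k (Pair s r), possible k (Pair s' r'),
      (0 <= a < g%:Z) && (0 <= c < g%:Z),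
      a + s * g%:Z = k%:Z * c + s' & k%:Z * a + r = c + g%:Z * r'].
Proof.
rewrite /edge /= => g_gt0; split.
  case=> pos_sr ca_range [/eqP + s'_range] _ [es er].
  rewrite eqz_mod_dvd => /dvdzP[q eq_q].
  move: er; rewrite eq_q mulzK => [er|]; last by lia.
  subst q; split; try by lia.
  by apply/andP; split; [lia | nia].
case=> pos_sr pos_s'r' ca_range es er.
have eq_r' : k%:Z * a + r - c = r' * g%:Z by lia.
split=> //; first by lia.
- split; last by lia.
  by apply/eqP; rewrite eqz_mod_dvd; apply/dvdzP; exists r'.
- by congr Pair; [lia | rewrite eq_r' mulzK //; lia].
Qed.

Lemma edge_StartP c a v :
  edge g k Start c a v <-> [/\ edge g k (Pair 0 0) c a v, a <> 0 & c <> 0].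
Proof.
rewrite /edge /=; split.
  by case=> _ ? ? /(_ erefl)[? ?] ?; split=> //; split=> //; lia.
by case=> -[? ? ? ? ?] ? ?; split.
Qed.

Lemma edge_rev s r c a s' r' : (0 < g)%N ->
  edge g k (Pair s r) c a (Pair s' r') -> edge g k (Pair r' s') a c (Pair r s).
Proof.
by move=> g_gt0 /edgeP[] //= *; apply/edgeP => //; split=> /=; lia.
Qed.

Lemma young_node_swap s t r : (0 < g)%N ->
    young_arrow g k (Pair r r) (Pair s t) ->
    young_arrow g k (Pair s t) (Pair r r) ->
  young_node g k (Pair t s).
Proof.
move=> g_gt0 [c [a [[Hr [p [pivot_p rp]]] _ /edge_rev e_to_r]]].
move=> [c' [a' [_ _ /edge_rev e_from_r]]]; split.
  by apply: rt_trans Hr _; apply: rt_step; exists a', c'; apply: e_from_r.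
exists p; split=> //; apply: rt_trans rp; apply: rt_step.
by exists a, c; apply: e_to_r.
Qed.

Definition diag_label (r c a : int) : Prop :=
  a = k%:Z * c + r /\ k%:Z * a = c + g%:Z * r.

Lemma edge_from_zeroP r c a : (0 < g)%N ->
  edge g k (Pair 0 0) c a (Pair r r) <->
  [/\ diag_label r c a, 0 <= r < k%:Z, 0 <= a < g%:Z & 0 <= c < g%:Z].
Proof.
move=> g_gt0; rewrite edgeP //=; split.
  by case=> ? ? /andP[? ?] ? ?; split; rewrite // /diag_label; lia.
by case=> -[? ?] ? ? ?; split; lia.
Qed.

Lemma diag_label0 : diag_label 0 0 0.
Proof. by split; rewrite !mulr0. Qed.

Lemma diag_labelZ i r c a :
  diag_label r c a -> diag_label (i * r) (i * c) (i * a).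
Proof.
by case=> ea eka; split; [rewrite ea | rewrite mulrCA eka]; ring.
Qed.

Lemma diag_label_numeral (r : int) (c a : nat) :
  diag_label r c a -> (k * (c * g + a) = a * g + c)%N.
Proof. by case; nia. Qed.

Lemma digit_aB r r' : digit_a g k (r - r') = digit_a g k r - digit_a g k r'.
Proof. by rewrite /digit_a rmorphB mulrBl. Qed.

Lemma digit_bB r r' : digit_b g k (r - r') = digit_b g k r - digit_b g k r'.
Proof. by rewrite /digit_b rmorphB mulrBl. Qed.

Lemma digit_aM i r : digit_a g k (i * r) = i%:~R * digit_a g k r.
Proof. by rewrite /digit_a intrM -mulrA. Qed.

Lemma digit_bM i r : digit_b g k (i * r) = i%:~R * digit_b g k r.
Proof. by rewrite /digit_b intrM -mulrA. Qed.

Definition label_lattice : {pred int} :=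
  [pred r | (digit_a g k r \is a Num.int) && (digit_b g k r \is a Num.int)].

Lemma zmod_closed_label_lattice : zmod_closed label_lattice.
Proof.
split=> [|r r' /andP[? ?] /andP[? ?]]; last first.
  by rewrite inE digit_aB digit_bB !rpredB.
by rewrite inE /digit_a /digit_b !mul0r rpred0.
Qed.

End Edges.

Section YoungGraph.
Variables g k : nat.
Hypotheses (k_gt1 : (1 < k)%N) (k_lt_g : (k < g)%N).

Let g_gt0 : (0 < g)%N. Proof. by apply: leq_ltn_trans k_lt_g. Qed.

Let denom_gt0 : 0 < k%:R ^+ 2 - 1 :> rat.
Proof. by rewrite subr_gt0 exprn_egt1 // ltr1n. Qed.

Lemma digit_a_gt0 r : (0 < digit_a g k r) = (0 < r).
Proof.
rewrite pmulr_lgt0 ?ltr0z // divr_gt0 ?denom_gt0 // subr_gt0 -natrM ltr1n.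
by nia.
Qed.

Lemma digit_b_gt0 r : (0 < digit_b g k r) = (0 < r).
Proof.
by rewrite pmulr_lgt0 ?ltr0z // divr_gt0 ?denom_gt0 // subr_gt0 ltr_nat.
Qed.

Lemma diag_labelP r c a :
  diag_label g k r c a <-> digit_b g k r = c%:~R /\ digit_a g k r = a%:~R.
Proof.
have den_neq0 := lt0r_neq0 denom_gt0; rewrite /digit_a /digit_b !mulrA.
split=> [[ea eka]|[eb ea]].
  have {}ea : a%:~R = k%:R * c%:~R + r%:~R :> rat by rewrite ea intrD intrM.
  have {}eka : k%:R * a%:~R = c%:~R + g%:R * r%:~R :> rat.
    by have := congr1 (intr : int -> rat) eka; rewrite intrD !intrM.
  have eGr : g%:R * r%:~R = k%:R * (k%:R * c%:~R + r%:~R) - c%:~R :> rat.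
    by rewrite -ea eka addrC addKr.
  by split; apply: (canLR (mulfK den_neq0)); ring: ea eGr.
move: eb ea => /(canRL (divfK den_neq0)) eb /(canRL (divfK den_neq0)) ea.
split; apply: (@intr_inj rat); rewrite intrD !intrM;
  by apply: (mulIf den_neq0); rewrite mulrDl -mulrA -eb -ea; ring.
Qed.

Lemma diag_label_inj r c a c' a' :
  diag_label g k r c a -> diag_label g k r c' a' -> c = c' /\ a = a'.
Proof.
case/diag_labelP=> eb ea /diag_labelP[].
by rewrite eb ea => /intr_inj-> /intr_inj->.
Qed.

Lemma diag_label_gt0 r c a : diag_label g k r c a -> 0 < r -> 0 < c /\ 0 < a.
Proof.
case/diag_labelP=> eb ea r_gt0.
by rewrite -!(ltr0z rat) -eb -ea digit_b_gt0 digit_a_gt0.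
Qed.

Lemma admissibleP r :
  admissible g k r <-> exists c a, [/\ diag_label g k r c a, 0 < r & a < g%:Z].
Proof.
rewrite /admissible digit_a_gt0 digit_b_gt0; split.
  move=> [/intrP[a ea] r_gt0 a_lt /intrP[c ec] _]; exists c, a.
  by split; rewrite ?diag_labelP // -(ltr_int rat) -ea.
case=> c [a [/diag_labelP[-> ->] r_gt0 a_lt]].
by split; rewrite ?intr_int // -[g%:R]/(g%:Z%:~R) ltr_int.
Qed.

Lemma admissible_nat_label r0 : admissible g k r0 ->
  exists r b a : nat, [/\ r0 = r, (0 < r)%N & diag_label g k r b a].
Proof.
case/admissibleP=> c [a [lab r0_gt0 _]].
have [c_gt0 a_gt0] := diag_label_gt0 lab r0_gt0.
by exists `|r0|%N, `|c|%N, `|a|%N; rewrite !gtz0_abs // absz_gt0 gt_eqF.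
Qed.

Lemma admissible_gt0 r : admissible g k r -> 0 < r.
Proof. by case/admissibleP=> c [a []]. Qed.

Lemma admissible_arrowP r : admissible g k r <-> arrow g k Start (Pair r r).
Proof.
rewrite admissibleP; split=> -[c [a]].
  case=> lab r_gt0 a_lt; have [c_gt0 a_gt0] := diag_label_gt0 lab r_gt0.
  exists c, a; apply/edge_StartP; split; [|lia|lia].
  apply/edge_from_zeroP => //; split=> //; last by case: lab; nia.
    by case: lab; nia.
  by rewrite a_lt ltW.
case/edge_StartP=> /edge_from_zeroP[] // lab r_range a_range c_range _ c_neq0.
exists c, a; split=> //; last by case/andP: a_range.
rewrite -digit_b_gt0; case/diag_labelP: lab => -> _; rewrite ltr0z; lia.
Qed.

Lemma diag_edge_label r c a r' c' a' x y :
    diag_label g k r c a -> diag_label g k r' c' a' ->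
    edge g k (Pair r r) x y (Pair r' r') ->
  x = c' + a /\ y = a' + c.
Proof.
move=> [ea eka] [ea' eka'] /edgeP[] // _ _ _ es er.
have lab : diag_label g k 0 (x - c' - a) (y - a' - c) by split; lia.
by have [] := diag_label_inj lab (diag_label0 g k); lia.
Qed.

Lemma young_arrow_label u r :
    u = Start \/ u = Pair 0 0 -> young_arrow g k u (Pair r r) ->
  the_edge_label g k u (Pair r r) (digit_b g k r) (digit_a g k r).
Proof.
move=> u_zero [c [a e]].
have label_of c' a' :
    young_edge g k u c' a' (Pair r r) -> diag_label g k r c' a'.
  case=> _ _ e'; have {}e' : edge g k (Pair 0 0) c' a' (Pair r r).
    by case: u_zero e' => -> // /edge_StartP[].
  by have [] := (edge_from_zeroP _ _ _ _ g_gt0).1 e'.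
have lab := label_of _ _ e.
have [eb ea] := (diag_labelP _ _ _).1 lab.
exists c, a; split=> // c' a'; split=> [/label_of lab'|[-> ->] //].
exact: diag_label_inj lab' lab.
Qed.

Lemma complete_Start_label m r : young_is_complete g k m ->
    young_node g k (Pair r r) -> r != 0 ->
  the_edge_label g k Start (Pair r r) (digit_b g k r) (digit_a g k r).
Proof.
case=> _ _ _ Start_to node_r /eqP r_neq0.
by apply: young_arrow_label; [left | apply: Start_to => // -[]].
Qed.

Lemma complete_zero_label m r : young_is_complete g k m ->
    young_node g k (Pair 0 0) -> young_node g k (Pair r r) ->
  the_edge_label g k (Pair 0 0) (Pair r r) (digit_b g k r) (digit_a g k r).
Proof.
case=> _ _ all_arrows _ node_0 node_r.
by apply: young_arrow_label; [right | apply: all_arrows].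
Qed.

(* The loop at [i r, i r] is labelled (i (c + a), i (c + a)). *)
Lemma complete_label_lt m i r c a : young_is_complete g k m ->
    young_node g k (Pair (i * r) (i * r)) -> diag_label g k r c a ->
  i * (c + a) < g%:Z.
Proof.
case=> _ _ all_arrows _ node_ir /(diag_labelZ i) lab.
have [x [y [_ _ loop]]] := all_arrows _ _ _ _ node_ir node_ir.
rewrite mulrDr; have [<- _] := diag_edge_label lab lab loop.
by case/edgeP: loop => // _ _ /and3P[_ _].
Qed.

Lemma admissible_multipleP r0 r :
    admissible g k r0 -> (forall r, admissible g k r -> r0 <= r) ->
  admissible g k r <->
  exists i : nat,
    [/\ (0 < i)%N, r = i%:Z * r0 & i%:R * digit_a g k r0 < g%:R].
Proof.
move=> adm_r0 r0_min; have r0_gt0 := admissible_gt0 adm_r0.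
have lattice_adm r' : admissible g k r' -> r' \in label_lattice g k.
  by case=> ? _ _ ? _; apply/andP.
split=> [adm_r|[i [i_gt0 -> a_lt]]].
  have : (r0 %| r)%Z.
    have zmodL := zmod_closed_label_lattice g k.
    apply: (min_pos_dvdz zmodL); rewrite ?lattice_adm //.
    move=> r' /andP[int_a int_b] r'_gt0; rewrite leNgt; apply/negP => r'_lt.
    suff /r0_min : admissible g k r' by rewrite leNgt r'_lt.
    split; rewrite ?digit_a_gt0 ?digit_b_gt0 //.
    case: adm_r0 => _ _ + _ _; apply: lt_trans.
    by rewrite -subr_gt0 -digit_aB digit_a_gt0 subr_gt0.
  case/dvdzP=> i er; have i_gt0 : 0 < i.
    by rewrite -(pmulr_lgt0 _ r0_gt0) -er admissible_gt0.
  exists `|i|%N; rewrite absz_gt0 gt_eqF // gez0_abs ?ltW //; split=> //.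
  case: adm_r => _ _ + _ _; rewrite er digit_aM.
  by rewrite natr_absz ger0_norm // ltW.
have [int_a _ _ int_b _] := adm_r0.
have ir0_gt0 : 0 < i%:Z * r0 by rewrite mulr_gt0.
split; rewrite ?digit_a_gt0 ?digit_b_gt0 //.
- by rewrite digit_aM (rpredM (intr_int _ _) int_a).
- by rewrite digit_aM.
- by rewrite digit_bM (rpredM (intr_int _ _) int_b).
Qed.

Lemma admissible_multiples n r0 r :
    exactly n (admissible g k) ->
    admissible g k r0 -> (forall r, admissible g k r -> r0 <= r) ->
  admissible g k r <-> exists i : nat, (0 < i <= n)%N /\ r = i%:Z * r0.
Proof.
move=> count_adm adm_r0 r0_min.
have [/intrP[a ea] a_gt0 _ _ _] := adm_r0; rewrite ea ltr0z in a_gt0.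
pose q := ((g - 1) %/ `|a|)%N.
have le_q i : (i%:R * digit_a g k r0 < g%:R) = (i <= q)%N.
  rewrite ea leq_divRL ?absz_gt0 ?gt_eqF // -[g%:R]/(g%:Z%:~R).
  by rewrite -[i%:R]/(i%:Z%:~R) -intrM ltr_int; nia.
have admP r' : admissible g k r' <->
    exists i : nat, (0 < i <= q)%N /\ r' = i%:Z * r0.
  rewrite (admissible_multipleP r' adm_r0 r0_min); split=> -[i].
    by rewrite le_q => -[? ? ?]; exists i; split=> //; apply/andP.
  by case=> /andP[? ?] ->; exists i; rewrite le_q.
have r0_neq0 : r0 != 0 by rewrite gt_eqF ?admissible_gt0.
by rewrite (eq_exactly admP count_adm (exactly_multiples q r0_neq0)).
Qed.

Lemma admissible_young_node r :
  admissible g k r -> young_node g k (Pair r r).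
Proof.
move=> /admissible_arrowP Start_r; have H_r := rt_step _ _ _ _ Start_r.
split=> //; exists (Pair r r); split; last exact: rt_refl.
by left; split=> //; exists r.
Qed.

Lemma complete_diag_admissible m r : young_is_complete g k m ->
  young_node g k (Pair r r) -> r != 0 -> admissible g k r.
Proof.
case=> _ _ _ Start_to node_r /eqP r_neq0; apply/admissible_arrowP.
by have [|c [a [_ _ e]]] := Start_to _ _ node_r; [case | exists c, a].
Qed.

Lemma complete_young_nodeP m s r : (1 < m)%N ->
    exactly (m - 1)%N (admissible g k) -> young_is_complete g k m ->
  young_node g k (Pair s r) <-> s = r /\ (r = 0 \/ admissible g k r).
Proof.
move=> m_gt1 [A [uniq_A size_A AP]] complete.
have [_ [Y [uniq_Y size_Y YP]] all_arrows _] := complete.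
have [d adm_d] : exists d, admissible g k d.
  by exists (nth 0 A 0); apply/AP/mem_nth; lia.
have swapY x : x \in Y -> (x.2, x.1) \in Y.
  move=> /YP node_x; have node_d := admissible_young_node adm_d.
  by apply/YP/(@young_node_swap _ _ _ _ d) => //; apply: all_arrows.
pose D := [seq (t, t) | t <- A].
have [||||x D_x eqY] := @uniq_eq_cons _ D Y; rewrite ?map_inj_uniq //.
- by move=> t t' [].
- by move=> _ /mapP[t /AP/admissible_young_node ? ->]; apply/YP.
- by rewrite size_map size_A size_Y; lia.
have x_diag : x.1 = x.2.
  have := swapY x; rewrite !eqY mem_head => /(_ isT).
  case/predU1P=> [/(congr1 snd) //|].
  by case/mapP=> t _ [-> ->].
have x_zero : x = (0, 0).
  case: x x_diag D_x eqY => t _ /= <- D_t eqY.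
  have [-> //|t_neq0] := eqVneq t 0; case/negP: D_t; apply/map_f/AP.
  apply: complete_diag_admissible complete _ t_neq0.
  by apply/(YP (t, t)); rewrite eqY mem_head.
rewrite -(YP (s, r)) eqY x_zero inE; split.
  case/predU1P=> [[-> ->]|/mapP[t /AP ? [-> ->]]]; first by split=> //; left.
  by split=> //; right.
by case=> -> [->|/AP A_r]; rewrite ?eqxx // map_f ?orbT.
Qed.

Lemma complete_young_multiples m r0 : (1 < m)%N ->
    exactly (m - 1)%N (admissible g k) -> young_is_complete g k m ->
    admissible g k r0 -> (forall r, admissible g k r -> r0 <= r) ->
  forall s r, young_node g k (Pair s r) <->
    exists i : nat, [/\ (i <= m - 1)%N, s = i%:Z * r0 & r = i%:Z * r0].
Proof.
move=> m_gt1 count_adm complete adm_r0 r0_min s r.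
rewrite (complete_young_nodeP s r m_gt1 count_adm complete).
rewrite (admissible_multiples r count_adm adm_r0 r0_min).
split=> [[-> [->|[i [/andP[_ i_le] ->]]]]|[[|i] [i_le -> ->]]].
- by exists 0%N; rewrite mul0r.
- by exists i.
- by rewrite mul0r; split=> //; left.
- by split=> //; right; exists i.+1.
Qed.

End YoungGraph.

Section ReverseMultipleDigits.
Variables g k : nat.
Hypothesis g_gt0 : (0 < g)%N.

Definition revmul_digits (l : seq nat) : Prop :=
  [/\ digits_below g l, last 0%N l != 0%N
    & (k * lsd_value g l)%N = lsd_value g (rev l)].

Lemma revmul_lenP t N : revmul_len g k t N <->
  exists l, [/\ size l = t, revmul_digits l & N = lsd_value g l].
Proof.
rewrite /revmul_len; split.
  case/andP=> _ /existsP[ds /andP[]] /=.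
  rewrite is_expansionE numeralE => /and3P[ds_lt ds_last /eqP eN] /eqP ekN.
  exists (rev [seq val d | d <- ds]); rewrite size_rev size_map size_tuple.
  by split=> //; split; rewrite // -eN ekN.
case=> l [size_l [l_lt l_last ekN] eN].
pose ds : seq 'I_g := pmap insub (rev l).
have map_ds : [seq val d | d <- ds] = rev l.
  rewrite (pmap_filter (insubK _)); apply/all_filterP; rewrite all_rev.
  by apply: sub_all l_lt => d d_lt; rewrite isSome_insub.
have size_ds : size ds == t by rewrite -(size_map val) map_ds size_rev size_l.
rewrite eN lsd_value_gt0 //=; apply/existsP; exists (Tuple size_ds).
by rewrite /= map_ds is_expansionE numeral_rev revK l_lt l_last -ekN !eqxx.
Qed.

Lemma revmul_len_lt t N : revmul_len g k t N -> (N < g ^ t)%N.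
Proof. by case/revmul_lenP=> l [<- [l_lt _ _] ->]; apply: lsd_value_lt. Qed.

Lemma count_revmulE t (s : seq nat) : uniq s ->
  revmul_len g k t =1 mem s -> count_revmul g k t = size s.
Proof.
move=> uniq_s sP; rewrite /count_revmul cardE -(size_map val).
apply/perm_size/uniq_perm => //.
  by rewrite map_inj_uniq ?enum_uniq //; apply: val_inj.
move=> N; apply/mapP/idP => [[x]|s_N].
  by rewrite mem_enum inE sP => ? ->.
have N_lt : (N < g ^ t)%N by apply: revmul_len_lt; rewrite sP.
by exists (Ordinal N_lt); rewrite // mem_enum inE sP.
Qed.

Lemma revmul_len0 N : revmul_len g k 0 N = false.
Proof. by apply/negP => /revmul_lenP[l [/size0nil-> []]]. Qed.

Lemma count_revmul0 : count_revmul g k 0 = 0%N.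
Proof.
by rewrite (count_revmulE (s := [::])) // => N; rewrite revmul_len0.
Qed.

Hypothesis k_gt0 : (0 < k)%N.
Variable l : seq nat.
Hypothesis revmul_l : revmul_digits l.

Let l_lt : digits_below g l. Proof. by case: revmul_l. Qed.
Let l_last : last 0%N l != 0%N. Proof. by case: revmul_l. Qed.
Let carry_l := carry g k (lsd_value g l).

Lemma size_revmul_digits_gt0 : (0 < size l)%N.
Proof. by case: (l) l_last. Qed.

Lemma carry_size : carry_l (size l) = 0%N.
Proof.
apply: carry_eq0 => //; case: revmul_l => _ _ ->.
by rewrite -(size_rev l) lsd_value_lt // all_rev.
Qed.

Lemma carry_digits j : (j < size l)%N ->
  (k * nth 0 l j + carry_l j = nth 0 l (size l - j.+1) + g * carry_l j.+1)%N.
Proof.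
move=> j_lt; rewrite (nth_digit _ l_lt) carryS //; case: revmul_l => _ _ ->.
by rewrite -nth_digit ?all_rev // nth_rev.
Qed.

Definition carry_node (j : nat) : node :=
  Pair (carry_l (size l - j))%:Z (carry_l j)%:Z.

Lemma carry_node0 : carry_node 0 = Pair 0 0.
Proof. by rewrite /carry_node subn0 carry_size /carry_l carry0. Qed.

Lemma carry_node_size : carry_node (size l) = Pair 0 0.
Proof. by rewrite /carry_node subnn carry_size /carry_l carry0. Qed.

Lemma carry_edge j : (j < size l)%N ->
  edge g k (carry_node j) (nth 0%N l (size l - j.+1)) (nth 0%N l j)
    (carry_node j.+1).
Proof.
move=> j_lt; apply/edgeP => //.
have digit_lt i : (nth 0 l i < g)%N.
  have [i_lt|i_ge] := ltnP i (size l); last by rewrite nth_default.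
  by move/all_nthP: l_lt; apply.
have carry_ltk i : (carry_l i < k)%N by apply: carry_lt.
have := carry_digits j_lt.
have := @carry_digits (size l - j.+1); rewrite -subSn // subSS.
rewrite (subKn (ltnW j_lt)) leq_subr => /(_ isT).
have := carry_ltk j; have := carry_ltk j.+1.
have := carry_ltk (size l - j)%N; have := carry_ltk (size l - j.+1)%N.
have := digit_lt j; have := digit_lt (size l - j.+1)%N.
by split=> /=; lia.
Qed.

Lemma carry_arrow_Start : arrow g k Start (carry_node 1).
Proof.
have := carry_edge size_revmul_digits_gt0; rewrite carry_node0 subn1 nth_last.
move=> e; exists (last 0%N l), (nth 0%N l 0); apply/edge_StartP; split=> //.
  by case/edgeP: e => // _ _ _ + _; move: l_last; nia.
by move: l_last; lia.
Qed.

Lemma carry_reach i j : (i <= j <= size l)%N ->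
  reach g k (carry_node i) (carry_node j).
Proof.
elim: j => [|j IHj]; first by rewrite leqn0 => /andP[/eqP-> _]; apply: rt_refl.
rewrite leq_eqVlt ltnS => /andP[/predU1P[-> _|i_le j_lt]]; first exact: rt_refl.
apply: rt_trans (IHj _) _; first by rewrite i_le ltnW.
by apply: rt_step; do 2!eexists; apply: carry_edge.
Qed.

(* The last carry vanishes, so the path ends in the pivot node [0, 0]. *)
Lemma carry_young_node j : (0 < j <= size l)%N -> young_node g k (carry_node j).
Proof.
have H_carry i : (0 < i <= size l)%N -> H_node g k (carry_node i).
  by move=> i_range; apply: rt_trans (carry_reach i_range);
    apply/rt_step/carry_arrow_Start.
case/andP=> j_gt0 j_le; split; first by apply: H_carry; apply/andP.
exists (carry_node (size l)); split; last first.
  by apply: carry_reach; rewrite j_le leqnn.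
left; split; last by exists 0; rewrite carry_node_size.
by apply: H_carry; rewrite size_revmul_digits_gt0 /=.
Qed.

End ReverseMultipleDigits.

Section ReverseMultiplesOfCompleteGraph.
Variables g k m r b a : nat.
Hypotheses (k_gt1 : (1 < k)%N) (k_lt_g : (k < g)%N).
Hypotheses (m_gt0 : (0 < m)%N) (r_gt0 : (0 < r)%N).
Hypothesis lab : diag_label g k r b a.
Hypothesis digit_bound : ((m - 1) * (a + b) < g)%N.
Hypothesis young_nodeP : forall s t, young_node g k (Pair s t) <->
  exists i : nat, [/\ (i <= m - 1)%N, s = i%:Z * r & t = i%:Z * r].

Let g_gt0 : (0 < g)%N. Proof. exact: leq_ltn_trans k_lt_g. Qed.
Let k_gt0 : (0 < k)%N. Proof. exact: ltnW. Qed.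

Let b_gt0 : (0 < b)%N.
Proof. by have [] := diag_label_gt0 k_gt1 k_lt_g lab; rewrite ?ltz_nat. Qed.

Lemma revmul_digits_scaled n l :
  l \in palindromes 1 m n -> revmul_digits g k (scaled_digits a b l).
Proof.
rewrite mem_palindromes => /and4P[_ /eqP pal_l l_lt l_head]; split.
- exact: scaled_digits_below l_lt digit_bound.
- rewrite last_scaled_digits -head_rev pal_l -lt0n muln_gt0 l_head.
  exact: b_gt0.
rewrite rev_scaled_digits pal_l !lsd_value_scaled mulnA.
by rewrite (diag_label_numeral lab).
Qed.

Section Carries.
Variable l : seq nat.
Hypothesis revmul_l : revmul_digits g k l.

Let mult (j : nat) : nat := carry g k (lsd_value g l) j %/ r.

Lemma carry_multiple j : (j <= size l)%N ->
  [/\ (mult j <= m - 1)%N,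
      carry_node g k l j = Pair ((mult j)%:Z * r) ((mult j)%:Z * r)
    & mult (size l - j) = mult j].
Proof.
case: j => [_|j j_lt].
  by rewrite carry_node0 // /mult subn0 carry_size // carry0 div0n !mul0r.
have node_j := carry_young_node g_gt0 k_gt0 revmul_l (j := j.+1) j_lt.
have [i [i_le]] := (young_nodeP _ _).1 node_j; rewrite -PoszM.
case=> eq_rev [eq_carry]; rewrite /carry_node /mult eq_rev eq_carry mulnK //.
Qed.

Lemma nth_revmul_digits j : (j < size l)%N ->
  nth 0%N l j = (mult j.+1 * a + mult j * b)%N.
Proof.
move=> j_lt; have e := carry_edge g_gt0 k_gt0 revmul_l j_lt.
have [_ node_j _] := carry_multiple (ltnW j_lt).
have [_ node_Sj _] := carry_multiple j_lt.
rewrite node_j node_Sj in e.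
have [_] := diag_edge_label k_gt1 k_lt_g (diag_labelZ (mult j)%:Z lab)
  (diag_labelZ (mult j.+1)%:Z lab) e.
by lia.
Qed.

Lemma revmul_digits_palindrome :
  exists2 w, w \in palindromes 1 m (size l).-1 & l = scaled_digits a b w.
Proof.
have size_gt0 := size_revmul_digits_gt0 revmul_l.
case def_n: (size l) (size_gt0) => [//|n] _ /=.
pose w := mkseq (fun j => mult j.+1) n.
have mult0 : mult 0 = 0%N by rewrite /mult carry0 div0n.
have multSn : mult n.+1 = 0%N by rewrite /mult -def_n carry_size // div0n.
have l_scaled : l = scaled_digits a b w.
  apply: (@eq_from_nth _ 0%N); rewrite ?size_scaled_digits ?size_mkseq def_n //.
  move=> j j_lt; rewrite nth_revmul_digits ?def_n //.
  rewrite /scaled_digits -multSn -mkseqS (nth_pairmap 0%N) ?size_mkseq //.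
  rewrite nth_mkseq // multSn; congr (_ + _ * _)%N.
  by case: j j_lt => [|j] j_lt //=; rewrite nth_mkseq // ltnW.
have pal_w : rev w = w.
  apply: rev_mkseq_sym => i i_lt; have [|_ _ <-] := @carry_multiple i.+1.
    by rewrite def_n ltnS ltnW.
  by rewrite def_n subSS -subSn.
exists w => //; rewrite mem_palindromes size_mkseq pal_w !eqxx /=.
apply/andP; split.
  apply/allP => x /mapP[i]; rewrite mem_iota => i_lt ->.
  by have [|] := @carry_multiple i.+1; rewrite ?def_n; lia.
rewrite -pal_w head_rev; case: revmul_l => _ + _.
by rewrite l_scaled last_scaled_digits muln_eq0 lt0n; case: eqP.
Qed.

End Carries.

Lemma revmul_lenE n :
  revmul_len g k n.+1 =1
  mem [seq ((b * g + a) * lsd_value g l)%N | l <- palindromes 1 m n].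
Proof.
move=> N; apply/idP/mapP => [|[l pal_l ->]].
  case/(revmul_lenP k g_gt0) => l [size_l rev_l ->].
  have [w pal_w l_scaled] := revmul_digits_palindrome rev_l.
  by exists w; rewrite ?l_scaled ?lsd_value_scaled // -[n]/n.+1.-1 -size_l.
apply/(revmul_lenP k g_gt0).
exists (scaled_digits a b l); split; last by rewrite lsd_value_scaled.
  by move: pal_l; rewrite size_scaled_digits mem_palindromes => /andP[/eqP->].
exact: revmul_digits_scaled pal_l.
Qed.

Let m_le_g : (m <= g)%N.
Proof. by have := b_gt0; move: digit_bound m_gt0; nia. Qed.

Lemma count_revmulS n : count_revmul g k n.+1 = size (palindromes 1 m n).
Proof.
rewrite (count_revmulE g_gt0 _ (revmul_lenE n)) ?size_map //.
rewrite map_inj_in_uniq ?uniq_palindromes // => l l' pal_l pal_l' /eqP.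
have ba_gt0 : (0 < b * g + a)%N by rewrite addn_gt0 muln_gt0 b_gt0 g_gt0.
rewrite eqn_pmul2l // => /eqP; apply: lsd_value_inj.
- move: pal_l pal_l'; rewrite !mem_palindromes.
  by case/andP=> /eqP-> _ /andP[/eqP->].
- exact: palindrome_digits_below m_le_g pal_l.
- exact: palindrome_digits_below m_le_g pal_l'.
Qed.

Lemma revmul_palindromeP N : revmul g k N <->
  exists beta : nat, [/\ (0 < beta)%N, palindrome_below g m beta
    & N = (numeral g [:: b; a] * beta)%N].
Proof.
have -> : numeral g [:: b; a] = (b * g + a)%N.
  by rewrite numeralE /rev /=; ring.
split=> [[[|n]]|[beta [_ /(palindrome_belowP _ m_le_g)[n [l [pal_l ->]]] ->]]].
- by rewrite (revmul_len0 k g_gt0).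
- rewrite revmul_lenE => /mapP[l pal_l ->]; exists (lsd_value g l).
  have pal_V : palindrome_below g m (lsd_value g l).
    by apply/palindrome_belowP => //; exists n, l.
  by split=> //; case: pal_V => ds [/(expansion_gt0 g_gt0)].
by exists n.+1; rewrite revmul_lenE; apply: map_f.
Qed.

Lemma revmul_gfE :
  [/\ revmul_gf g k 0%N = 0, revmul_gf g k 1%N = 0
    & forall n, revmul_gf g k n.+2 = (m%:Z - 1) * m%:Z ^+ n./2].
Proof.
rewrite /revmul_gf (count_revmul0 k g_gt0).
split=> [||n]; rewrite ?count_revmulS //.
by rewrite size_palindromes PoszM rmorphXn /= subzn.
Qed.

End ReverseMultiplesOfCompleteGraph.

Theorem theorem6 (g k m : nat) (r0 : int)
  (g_ge3 : (3 <= g)%N) (k_ge2 : (2 <= k)%N) (k_lt_g : (k < g)%N)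
  (m_ge2 : (2 <= m)%N)
  (adm_count : exactly (m - 1)%N (admissible g k))
  (complete : young_is_complete g k m)
  (r0_adm : admissible g k r0)
  (r0_min : forall r : int, admissible g k r -> r0 <= r) :
  [/\ (* (i) *)
      [/\ forall s r : int, young_node g k (Pair s r) <->
            exists i : nat,
              [/\ (i <= m - 1)%N, s = i%:Z * r0 & r = i%:Z * r0],
          forall i : nat, (1 <= i <= m - 1)%N ->
            the_edge_label g k Start (Pair (i%:Z * r0) (i%:Z * r0))
              (digit_b g k (i%:Z * r0)) (digit_a g k (i%:Z * r0))
        & forall i : nat, (i <= m - 1)%N ->
            the_edge_label g k (Pair 0 0) (Pair (i%:Z * r0) (i%:Z * r0))
              (digit_b g k (i%:Z * r0)) (digit_a g k (i%:Z * r0))],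
      (* (ii) *)
      [/\ series_is_frac (revmul_gf g k)
            ((m%:Z - 1)%:P * 'X^2 * (1 + 'X)) (1 - m%:Z%:P * 'X^2),
          revmul_gf g k 0%N = 0, revmul_gf g k 1%N = 0
        & forall j : nat,
            revmul_gf g k (2 * j + 2)%N = (m%:Z - 1) * m%:Z ^+ j /\
            revmul_gf g k (2 * j + 3)%N = (m%:Z - 1) * m%:Z ^+ j]
    & (* (iii) *)
      exists b a : nat,
        [/\ b%:R = digit_b g k r0, a%:R = digit_a g k r0,
            is_expansion g [:: b; a] (numeral g [:: b; a])
          & forall N : nat, revmul g k N <->
              exists beta : nat, [/\ (0 < beta)%N, palindrome_below g m beta
                & N = (numeral g [:: b; a] * beta)%N]]].
Proof.
have [r [b [a [er0 r_gt0 lab]]]] := admissible_nat_label k_ge2 k_lt_g r0_adm.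
subst r0; have nodeP := complete_young_multiples k_ge2 k_lt_g m_ge2 adm_count
  complete r0_adm r0_min.
have node i : (i <= m - 1)%N -> young_node g k (Pair (i%:Z * r) (i%:Z * r)).
  by move=> i_le; apply/nodeP; exists i.
have node0 : young_node g k (Pair 0 0) by have := node 0%N isT; rewrite mul0r.
have digit_bound : ((m - 1) * (a + b) < g)%N.
  have := complete_label_lt k_ge2 k_lt_g complete (node _ (leqnn _)) lab.
  by rewrite addrC.
have [gf0 gf1 gfSS] := revmul_gfE k_ge2 k_lt_g (ltnW m_ge2) r_gt0 lab
  digit_bound nodeP.
have [eb ea] := (diag_labelP g k_ge2 _ _ _).1 lab.
split.
- split=> // i i_range; last first.
    exact: complete_zero_label complete node0 (node i i_range).
  apply: complete_Start_label complete _ _ => //; last by nia.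
  by apply: node; case/andP: i_range.
- split=> // [|j]; first exact: half_geometric_is_frac.
  by rewrite addn2 addn3 !gfSS mul2n doubleK /= uphalf_double.
- exists b, a; split; rewrite ?eb ?ea //.
    have [b_gt0 a_gt0] := diag_label_gt0 k_ge2 k_lt_g lab r_gt0.
    by rewrite /is_expansion /= eqxx; nia.
  exact: (revmul_palindromeP k_ge2 k_lt_g (ltnW m_ge2) r_gt0 lab digit_bound
    nodeP).
Qed.
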